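(* Let $X$ be any continuum. The following statements are equivalent. 1. $X$ does not have the fixed point property. 2. There is an inverse sequence $\{P_\ell,f_\ell\}_{\ell=1}^{\infty}$ of connected polyhedra $P_\ell$ and continuous surjections $f_\ell:P_{\ell+1}\to P_\ell$ such that $\varprojlim\{P_\ell,f_\ell\}_{\ell=1}^{\infty}$ is homeomorphic to $X$, and there is a continuous function $g:\varprojlim\{P_\ell,f_\ell\}_{\ell=1}^{\infty}\to\varprojlim\{P_\ell,f_\ell\}_{\ell=1}^{\infty}$ such that there exists $(n,m)\in\mathcal W$ such that $f_{n,m}(x)\notin T_{n,m}(g)(x)$ holds for each $x\in P_m$. 3. There is an inverse sequence $\{P_\ell,f_\ell\}_{\ell=1}^{\infty}$ of connected polyhedra $P_\ell$ and continuous surjections $f_\ell:P_{\ell+1}\to P_\ell$ such that $\varprojlim\{P_\ell,f_\ell\}_{\ell=1}^{\infty}$ is homeomorphic to $X$, and there is a continuous function $g:\varprojlim\{P_\ell,f_\ell\}_{\ell=1}^{\infty}\to\varprojlim\{P_\ell,f_\ell\}_{\ell=1}^{\infty}$ such that for each $(n,m)\in\mathcal W$, $f_{n,m}(x)\notin T_{n,m}(g)(x)$ holds for each $x\in P_m$.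
   Context: A continuum is a non-empty connected compact metric space (a single point is allowed). A space has the fixed point property if every continuous function from it to itself has a fixed point. Polyhedra here are compact (homeomorphic to the underlying space of a finite simplicial complex). $\mathcal W=\{(n,m)\in\mathbb N\times\mathbb N \mid n\le m\}$, where $\mathbb N$ is the set of positive integers. For compact metric spaces $P_\ell$ and continuous maps $f_\ell:P_{\ell+1}\to P_\ell$, the inverse limit $\varprojlim\{P_\ell,f_\ell\}_{\ell=1}^\infty$ is the subspace of $\prod_{\ell=1}^\infty P_\ell$ of all $(x_1,x_2,\ldots)$ with $x_\ell=f_\ell(x_{\ell+1})$ for all $\ell\ge1$, and $p_n$ is its $n$-th coordinate projection onto $P_n$. For $n<m$, $f_{n,m}=f_n\circ\cdots\circ f_{m-1}:P_m\to P_n$, and $f_{n,n}$ is the identity on $P_n$. For a function $g$ from $\varprojlim\{P_\ell,f_\ell\}_{\ell=1}^\infty$ to itself, $T_{n,m}(g)(x)=p_n(g(p_m^{-1}(x)))\subseteq P_n$ for $x\in P_m$. *)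

(* Defs.v *)
From HB Require Import structures.
From mathcomp Require Import all_boot all_order all_algebra finmap.
From mathcomp Require Import all_classical all_reals all_analysis.

Set Implicit Arguments.
Unset Strict Implicit.
Unset Printing Implicit Defensive.

Import Order.TTheory GRing.Theory Num.Theory.
Import numFieldNormedType.Exports.

Local Open Scope classical_set_scope.
Local Open Scope ring_scope.

Definition continuum (R : realType) (X : metricType R) : Prop :=
  [/\ [set: X] !=set0, connected [set: X] & compact [set: X]].

Definition fixed_point_property (X : topologicalType) : Prop :=
  forall h : X -> X, continuous h -> exists x : X, h x = x.

Definition homeomorphic (X Y : topologicalType) : Prop :=
  exists (h : X -> Y) (k : Y -> X),
    [/\ continuous h, continuous k, cancel h k & cancel k h].

Definition affinely_independent (R : realType) (V : lmodType R)
    (s : {fset V}) : Prop :=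
  forall c : V -> R,
    \sum_(v <- s) c v = 0 -> \sum_(v <- s) c v *: v = 0 ->
    forall v : V, v \in s -> c v = 0.

Definition convex_hull (R : realType) (V : lmodType R) (s : {fset V}) : set V :=
  [set x | exists c : V -> R,
    [/\ forall v, v \in s -> 0 <= c v,
        \sum_(v <- s) c v = 1
      & x = \sum_(v <- s) c v *: v]].

(* A simplex is represented by its finite set of vertices; its faces are then
   the nonempty subsets of that set. *)
Definition simplicial_complex (R : realType) (d : nat)
    (K : {fset {fset 'rV[R]_d}}) : Prop :=
  [/\ forall s, s \in K -> s != fset0 /\ affinely_independent s,
      forall s t, s \in K -> t != fset0 -> (t `<=` s)%fset -> t \in K
    & forall s t, s \in K -> t \in K ->
        convex_hull s `&` convex_hull t = set0 \/
        exists u : {fset 'rV[R]_d},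
          [/\ u != fset0, (u `<=` s)%fset, (u `<=` t)%fset
            & convex_hull s `&` convex_hull t = convex_hull u]].

Definition underlying_space (R : realType) (d : nat)
    (K : {fset {fset 'rV[R]_d}}) : set 'rV[R]_d :=
  [set x | exists2 s, s \in K & convex_hull s x].

Definition polyhedron (R : realType) (P : metricType R) : Prop :=
  exists (d : nat) (K : {fset {fset 'rV[R]_d}}),
    simplicial_complex K /\ homeomorphic P (set_type (underlying_space K)).

(* Inverse sequences are indexed from 0 instead of 1. *)
Definition inverse_limit_set (R : realType) (P : nat -> metricType R)
    (f : forall l, P l.+1 -> P l) : set (prod_topology P) :=
  [set x | forall l, x l = f l (x l.+1)].

Definition inverse_limit (R : realType) (P : nat -> metricType R)
    (f : forall l, P l.+1 -> P l) : topologicalType :=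
  set_type (inverse_limit_set f).

Definition projection (R : realType) (P : nat -> metricType R)
    (f : forall l, P l.+1 -> P l) (n : nat) (x : inverse_limit f) : P n :=
  set_val x n.

Arguments projection {R P f} n x.

Fixpoint bonding_add (R : realType) (P : nat -> metricType R)
    (f : forall l, P l.+1 -> P l) (n k : nat) : P (k + n)%N -> P n :=
  match k return P (k + n)%N -> P n with
  | 0 => fun x => x
  | k'.+1 => fun x => bonding_add f (f (k' + n)%N x)
  end.

(* f_{n,m} for n <= m: P m is transported to P ((m - n) + n). *)
Definition bonding (R : realType) (P : nat -> metricType R)
    (f : forall l, P l.+1 -> P l) (n m : nat) (nm : (n <= m)%N)
    (x : P m) : P n :=
  bonding_add f (ecast i (P i) (esym (subnK nm)) x).

Definition T_op (R : realType) (P : nat -> metricType R)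
    (f : forall l, P l.+1 -> P l) (n m : nat)
    (g : inverse_limit f -> inverse_limit f) (x : P m) : set (P n) :=
  projection n @` (g @` (projection m @^-1` [set x])).

Arguments T_op {R P f} n m g x.

(* Main.v *)
Require Import Defs.
From HB Require Import structures.
From mathcomp Require Import all_boot all_order all_algebra finmap.
From mathcomp Require Import all_classical all_reals all_analysis.
From mathcomp Require Import lra.

(* If [h] is a fixed-point-free self-map of [X], compactness keeps [h x] at
   distance more than some [e > 0] from [x].  It then suffices to write [X] as
   an inverse limit of connected polyhedra with surjective bonding maps whose
   projections all have fibers of diameter at most [e] (a form of Freudenthal's
   theorem): no point [y] of the limit can share a coordinate with [h y].

   The polyhedra are subcomplexes [L] of standard simplices, and come with maps
   [phi : X -> |L|] whose stars have small preimages, obtained from partitions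
   of unity.  Choosing [L] minimal makes [phi] irreducible: every map that
   shrinks the carriers of [phi] is onto [|L|], since a missed point would allow
   a radial push into a smaller complex.  A bonding map [|L'| -> |L|] sends a
   vertex [w] to the image under [phi] of a point in the star of [w], is
   extended affinely, and then collapsed into [L] by cutting off small
   barycentric coordinates.  Precomposed with [X -> |L'|], it shrinks the
   carriers of [phi], so it is onto.  The bonding maps commute with the [phi]'s
   only approximately; a thread [y] of the limit is sent to the limit of
   preimages in [X] of its coordinates. *)

Set Implicit Arguments.
Unset Strict Implicit.
Unset Printing Implicit Defensive.

Import Order.TTheory GRing.Theory Num.Theory.
Import numFieldNormedType.Exports.
Import metricType_numDomainType.

Local Open Scope classical_set_scope.
Local Open Scope ring_scope.

(** * Compactness and inverse limits *)

Lemma compact_set_type (T : topologicalType) (A : set T) :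
  compact A -> compact [set: set_type A].
Proof.
move=> cA F FF _.
have FA : (set_val @ F) A.
  by apply: (@filterS _ F _ setT) => [x _|];
    [exact: (set_mem (valP x))|exact: filterT].
have [p [Ap clp]] := cA (set_val @ F) _ FA.
have [q qp] : exists q : A, set_val q = p.
  by exists (exist _ p (mem_set Ap)); rewrite set_valE.
exists q; split=> // B C FB [_ [[D oD <-] /= Dq DC]].
have FB' : (set_val @ F) (set_val @` B).
  by apply: (@filterS _ F _ B) => // x Bx; exists x.
have nD : nbhs p D by apply: open_nbhs_nbhs; split=> //; rewrite -qp.
have [_ [[x Bx <-] Dx]] := clp _ _ FB' nD.
by exists x; split=> //; apply: DC.
Qed.

Lemma closed_equalizer (S T : topologicalType) (f g : S -> T) :
  hausdorff_space T -> continuous f -> continuous g ->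
  closed [set x | f x = g x].
Proof.
move=> hT cf cg x clx; apply: hT => U V Ux Vx.
have UV : nbhs x (f @^-1` U `&` g @^-1` V).
  by apply: filterI; [exact: cf|exact: cg].
have [y [/= fgy [Uy Vy]]] := clx _ UV.
by exists (f y); split=> //; rewrite fgy.
Qed.

Lemma compact_continuous_bij (S T : topologicalType) (f : S -> T) (g : T -> S) :
  compact [set: S] -> hausdorff_space T -> continuous f ->
  cancel f g -> cancel g f -> continuous g.
Proof.
move=> cS hT cf fK gK; apply/continuous_closedP => A clA.
have -> : g @^-1` A = f @` A.
  apply/seteqP; split=> [y Ay | _ [x Ax <-]]; last by rewrite /= fK.
  by exists (g y).
apply: compact_closed => //; apply: continuous_compact.
  exact: continuous_subspaceT.
exact: subclosed_compact clA cS _.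
Qed.

Lemma compact_unif_continuous (R : realType) (S T : metricType R) (f : S -> T) :
  compact [set: S] -> continuous f ->
  forall e : R, 0 < e ->
    exists2 d : R, 0 < d & forall x y, mdist x y < d -> mdist (f x) (f y) < e.
Proof.
move=> cS cf e e0.
have e20 : 0 < e / 2 by rewrite divr_gt0.
suff h : \forall d \near (0:R)^'+, [set: S] `<=`
    (fun x => forall y, mdist x y < d -> mdist (f x) (f y) < e).
  near (0:R)^'+ => d; exists d; first by near: d; exact: nbhs_right_gt.
  suff hd : [set: S] `<=`
      (fun x => forall y, mdist x y < d -> mdist (f x) (f y) < e).
    by move=> x; exact: hd.
  by near: d; exact: h.
have nc := (compact_near_coveringP [set: S]).1 cS.
apply: nc => x _.
have : nbhs x (fun t => mdist (f x) (f t) < e / 2).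
  exact: cvgr_dist_lt (cf x) _ e20.
move=> /nbhs_ballP[r /= r0 hr].
have r20 : 0 < r / 2 by rewrite divr_gt0.
exists ([set z | mdist x z < r / 2], [set d | d < r / 2]); first split => /=.
- by apply/nbhs_ballP; exists (r / 2) => //=; rewrite ballEmdist.
- exact: nbhs_right_lt.
move=> [z d] [/= xz dr] y zy.
have fxz : mdist (f x) (f z) < e / 2.
  apply: hr; rewrite ballEmdist /= (lt_trans xz)//.
  by rewrite ltr_pdivrMr// ltr_pMr// ltr1n.
have fxy : mdist (f x) (f y) < e / 2.
  apply: hr; rewrite ballEmdist /= (le_lt_trans (metric_triangle x z y))//.
  by rewrite [ltRHS]splitr ltrD// (lt_trans zy).
rewrite (le_lt_trans (metric_triangle _ (f x) _))// [ltRHS]splitr ltrD//.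
by rewrite metric_sym.
Unshelve. all: by end_near. Qed.

Section InverseLimit.
Variables (R : realType) (P : nat -> metricType R).
Variable f : forall l, P l.+1 -> P l.

Lemma projection_step (x : inverse_limit f) l :
  projection l x = f (projection l.+1 x).
Proof. exact: (set_mem (valP x) l). Qed.

Lemma bonding_projection (x : inverse_limit f) n m (nm : (n <= m)%N) :
  bonding f nm (projection m x) = projection n x.
Proof.
(* With [m - n] generalized to [k], the equation [e] can be substituted, and the transport in
   [bonding] disappears. *)
rewrite /bonding; move: (esym (subnK nm)) => {nm}; move: (m - n)%N => k e.
subst m => /=; by elim: k => //= k <-; rewrite -projection_step.
Qed.

Lemma projection_continuous n : continuous (@projection R P f n).
Proof.
move=> x; apply: (@continuous_comp _ (prod_topology P) _ set_val (proj n)).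
  exact: initial_continuous.
exact: proj_continuous.
Qed.

Lemma inverse_limit_ext (x y : inverse_limit f) :
  (forall n, projection n x = projection n y) -> x = y.
Proof. by move=> xy; apply/val_inj/functional_extensionality_dep. Qed.

Lemma compact_inverse_limit : (forall l, compact [set: P l]) ->
  (forall l, continuous (f (l:=l))) -> compact [set: inverse_limit f].
Proof.
move=> cP cf; apply: compact_set_type.
have cT : compact [set: prod_topology P].
  rewrite (_ : setT = [set x | forall i, [set: P i] (x i)]).
    exact: (@tychonoff _ P (fun=> setT)).
  by apply/seteqP; split.
apply: (subclosed_compact _ cT) => //.
rewrite (_ : inverse_limit_set f =
    \bigcap_l [set x : prod_topology P | x l = f (x l.+1)]); last first.
  by apply/seteqP; split=> x /= xf l; [move=> _|]; exact: xf.
apply: closed_bigI => l _.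
apply: (@closed_equalizer (prod_topology P) (P l) (fun x => x l)
  (fun x => f (x l.+1))).
- exact: metric_hausdorff.
- exact: (@proj_continuous _ P l).
- move=> x; apply: (@continuous_comp (prod_topology P) (P l.+1) _
    (fun x => x l.+1)).
    exact: (@proj_continuous _ P l.+1).
  exact: cf.
Qed.

End InverseLimit.

(** Coordinates above [m] are successive preimages and those below are forced. Shifting the whole
    sequence in the induction on [m] reduces to a [y] at index 0, where recursion on the index needs
    no casts. *)
Lemma surjective_thread (R : realType) (P : nat -> metricType R)
    (f : forall l, P l.+1 -> P l) :
  (forall l y, exists z, f l z = y) ->
  forall m (y : P m), exists x : inverse_limit f, projection m x = y.
Proof.
move=> sf m y.
suff [x xm xf] : exists2 x : forall l, P l,
    x m = y & forall l, x l = f l (x l.+1).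
  by exists (exist _ (x : prod_topology P)
    (mem_set (xf : inverse_limit_set f x))).
elim: m P f sf y => [|m IHm] P f sf y.
  exists (fun l => nat_rect P y (fun l z => sval (cid (sf l z))) l) => // l /=.
  by case: cid.
have [x xm xf] := IHm (fun l => P l.+1) (fun l => f l.+1) (fun l => sf l.+1) y.
by exists (fun l => match l return P l with
  0 => f 0 (x 0) | l'.+1 => x l' end) => // -[].
Qed.

(** * Recovering a compact space from maps that commute approximately with the bonding maps *)

Section LimitOfApproximations.
Variables (R : realType) (X : metricType R) (P : nat -> metricType R).
Variables (f : forall l, P l.+1 -> P l) (psi : forall l, X -> P l).
Variables (eps : nat -> R) (D : forall l, P l -> P l -> R).
Hypothesis compactX : compact [set: X].
Hypothesis compactP : forall l, compact [set: P l].
Hypothesis continuous_f : forall l, continuous (f (l:=l)).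
Hypothesis f_surj : forall l (y : P l), exists z, f z = y.
Hypothesis psi_surj : forall l (y : P l), exists a, psi l a = y.
Hypothesis eps_gt0 : forall l, 0 < eps l.
Hypothesis eps_half : forall l, eps l.+1 <= eps l / 2.
Hypothesis psi_near : forall l (y : P l), exists2 N, nbhs y N &
  forall a b, psi l a = y -> N (psi l b) -> mdist a b < eps l.
Hypothesis psi_step : forall l a b,
  f (psi l.+1 a) = psi l b -> mdist a b < eps l.
Hypothesis D_step : forall l (y z : P l.+1), D (f y) (f z) <= D y z.
Hypothesis D_pos : forall l (y z : P l), D y z <= 0 -> y = z.
Hypothesis D_small : forall l a b, mdist a b <= 4 * eps l.+1 ->
  D (f (psi l.+1 a)) (f (psi l.+1 b)) <= eps l.

Let eps_lt (e : R) n : 0 < e -> exists2 m, (n <= m)%N & eps m < e.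
Proof.
move=> e0.
have eps_exp m : eps m <= eps 0%N / 2 ^+ m.
  elim: m => [|m IHm]; first by rewrite divr1.
  rewrite (le_trans (eps_half m))// exprSr invfM mulrA ler_pM2r//.
have [k hk] : exists k : nat, eps 0%N / e < k%:R.
  by exists (Num.bound (eps 0%N / e)); rewrite archi_boundP// divr_ge0// ltW.
exists (maxn n k); first exact: leq_maxl.
rewrite (le_lt_trans (eps_exp _))// ltr_pdivrMr ?exprn_gt0// mulrC.
rewrite -ltr_pdivrMr// (lt_le_trans hk)//.
rewrite -natrX ler_nat (leq_trans (leq_maxr n k))// ltnW//.
exact: ltn_expl.
Qed.

(** By [psi_step], lifts of consecutive coordinates [n] and [n.+1] are within [eps n]; since [eps]
    at least halves, these bounds add up to at most [2 * eps n]. *)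
Let lift_dist (y : inverse_limit f) (a : nat -> X) :
  (forall l, psi l (a l) = projection l y) ->
  forall n k, mdist (a n) (a (n + k)%N) <= 2 * eps n.
Proof.
move=> ay n k; elim: k n => [|k IHk] n.
  by rewrite addn0 mdistxx mulr_ge0// ltW.
rewrite (le_trans (metric_triangle _ (a n.+1) _))//.
have d1 : mdist (a n) (a n.+1) < eps n.
  by rewrite metric_sym; apply: psi_step; rewrite !ay -projection_step.
have d2 := IHk n.+1; rewrite addSnnS in d2.
by have := eps_half n; lra.
Qed.

(** Quantifying over all lifts [a], not over one chosen sequence, lets any lift found later be
    compared with the same [x]. *)
Definition traced (y : inverse_limit f) (x : X) :=
  forall n a, psi n a = projection n y -> mdist a x <= 2 * eps n.

Let tracedE y : exists x, traced y x.
Proof.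
have [a ay] : exists a : nat -> X, forall l, psi l (a l) = projection l y.
  exists (fun l => sval (cid (psi_surj (projection l y)))) => l.
  by case: cid.
have [x [_ clx]] := @compactX (a @ \oo) _ filterT.
exists x => n b bn; apply/ler_addgt0Pr => e e0.
(* Replacing the lift at index [n] by [b] gives another sequence of lifts, so [lift_dist] bounds the
   distance from [b] to every later [a k]; these cluster at [x]. *)
pose a' l := if l == n then b else a l.
have a'y l : psi l (a' l) = projection l y.
  by rewrite /a'; case: eqP => [->|_].
have FA : (a @ \oo) [set a k | k in [set k | (n < k)%N]].
  by exists n.+1 => // k /= nk; exists k.
have [_ [[k /= nk <-] xk]] := clx _ _ FA (nbhsx_ballx x e e0).
move: xk; rewrite ballEmdist /= metric_sym => xk.
rewrite (le_trans (metric_triangle _ (a k) _))// lerD ?(ltW xk)//.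
have := lift_dist a'y n (k - n); rewrite subnKC ?(ltnW nk)//.
by rewrite /a' eqxx gtn_eqF.
Qed.

Let traced_continuous (Phi : inverse_limit f -> X) :
  (forall y, traced y (Phi y)) -> continuous Phi.
Proof.
move=> PhiP y; apply/(@cvgrPdist_lt _ _ _ (nbhs y) (nbhs_filter y)) => e e0.
(* The path from [Phi y] through the lifts [a] and [b] to [Phi z] costs 2 + 1 + 2 times [eps n]. *)
have [n _ en] := @eps_lt (e / 5) 0%N (ltac:(by rewrite divr_gt0)).
have [N nN hN] := psi_near (projection n y).
have nNy : nbhs y (projection n @^-1` N) by exact: projection_continuous.
have [a ay] := psi_surj (projection n y).
near=> z.
have [b bz] := psi_surj (projection n z).
have Nz : N (projection n z) by near: z; exact: nNy.
have dab : mdist a b < eps n by apply: hN => //; rewrite bz.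
have d1 := PhiP y n a ay; have d2 := PhiP z n b bz.
have t1 := metric_triangle (Phi y) a (Phi z).
have t2 := metric_triangle a b (Phi z).
rewrite (metric_sym _ a) in t1; lra.
Unshelve. all: by end_near. Qed.

(** Lifts of both threads at stage [m.+1] are within [4 * eps m.+1] of each other, through [x]. Then
    [D_small] bounds [D] at stage [m], [D_step] carries the bound down to stage [n], and [m] can be
    taken arbitrarily large. *)
Let traced_inj y z x : traced y x -> traced z x -> y = z.
Proof.
move=> yx zx; apply: inverse_limit_ext => n; apply: D_pos.
apply/ler_addgt0Pr => e e0; rewrite add0r.
have [m nm em] := eps_lt n e0.
have Dnm k : D (projection n y) (projection n z) <=
    D (projection (n + k) y) (projection (n + k) z).
  elim: k => [|k IHk]; first by rewrite addn0.
  by rewrite (le_trans IHk)// addnS (projection_step y) (projection_step z).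
have := Dnm (m - n)%N; rewrite subnKC// => /le_trans; apply.
rewrite (le_trans _ (ltW em))//.
have [a ay] := psi_surj (projection m.+1 y).
have [b bz] := psi_surj (projection m.+1 z).
rewrite (projection_step y) (projection_step z) -ay -bz D_small//.
have d1 := yx _ _ ay; have d2 := zx _ _ bz.
have := metric_triangle a x b; rewrite (metric_sym x b); lra.
Qed.

Lemma inverse_limit_homeomorphic :
  exists (Phi : inverse_limit f -> X) (k : X -> inverse_limit f),
    [/\ continuous Phi, continuous k, cancel Phi k, cancel k Phi
      & forall y, traced y (Phi y)].
Proof.
have [Phi PhiP] := choice tracedE.
have cPhi := traced_continuous PhiP.
have cL := compact_inverse_limit compactP continuous_f.
have surj x : exists y, Phi y = x.
  (* The range is closed, and it is dense because a thread through [psi m x] is sent within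
     [2 * eps m] of [x]. *)
  have clPhi : closed (range Phi).
    apply: compact_closed; first exact: metric_hausdorff.
    by apply: continuous_compact => //; exact: continuous_subspaceT.
  suff /clPhi[y _ <-] : closure (range Phi) x by exists y.
  move=> B /nbhs_ballP[e /= e0 xB].
  have [m _ em] := @eps_lt (e / 2) 0%N (ltac:(by rewrite divr_gt0)).
  have [y ym] := surjective_thread f_surj (psi m x).
  exists (Phi y); split; first by exists y.
  apply: xB; rewrite ballEmdist /= (le_lt_trans (PhiP y m x _))//.
  by rewrite -ltr_pdivlMl// mulrC.
have [k kK] := choice surj.
have Phik : cancel Phi k.
  move=> y; have := PhiP (k (Phi y)); rewrite kK => h.
  exact: traced_inj h (PhiP y).
exists Phi, k; split=> //.
exact: compact_continuous_bij cL (@metric_hausdorff _ _) cPhi Phik kK.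
Qed.

End LimitOfApproximations.

(** * Subcomplexes of a standard simplex *)

Section RowVectorMetric.
Variables (R : realType) (d : nat) (A : set 'rV[R]_d).

(** The sup norm turns the polyhedra into [metricType]s; by [ball_dist] it agrees with the structure
    that [set_type A] already carries. *)
Let dist (x y : set_type A) : R := `|set_val x - set_val y|.

Let dist_ge0 x y : 0 <= dist x y. Proof. exact: normr_ge0. Qed.

Let dist_eq0 x y : dist x y = 0 -> x = y.
Proof. by move/eqP; rewrite normr_eq0 subr_eq0 => /eqP/val_inj. Qed.

Let ball_dist (x : set_type A) e : ball x e = [set y | dist x y < e].
Proof. by rewrite -initial_ballE mx_norm_ball. Qed.

HB.instance Definition _ :=
  PseudoMetric_isMetric.Build R (set_type A) dist_ge0 dist_eq0 ball_dist.

End RowVectorMetric.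

Section Realization.
Variables (R : realType) (d : nat).
Implicit Types (s t : {set 'I_d}) (L : {set {set 'I_d}}) (y : 'rV[R]_d).

Definition barycentric y : Prop :=
  (forall v, 0 <= y 0 v) /\ \sum_v y 0 v = 1.

Definition carrier y : {set 'I_d} := [set v | 0 < y 0 v]%SET.

(** Indices that are not vertices are allowed, so simplices can be deleted without changing [d]. *)
Definition abstract_complex L : Prop :=
  finset.set0 \notin L /\
  forall s t, s \in L -> t != finset.set0 -> t \subset s -> t \in L.

(** A point of the standard simplex is interior to exactly one face, the one spanned by its
    [carrier]; membership is read off from that face. *)
Definition realization L : set 'rV[R]_d :=
  [set y | barycentric y /\ carrier y \in L].

Definition vertices s : {fset 'rV[R]_d} :=
  [fset u in [seq delta_mx 0 v | v <- enum s]]%fset.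

Lemma mem_carrier y v : (v \in carrier y) = (0 < y 0 v).
Proof. by rewrite inE. Qed.

Lemma barycentric_out y v : barycentric y -> v \notin carrier y -> y 0 v = 0.
Proof.
by move=> [y0 _]; rewrite mem_carrier lt0r y0 andbT negbK => /eqP.
Qed.

Lemma carrier_neq0 y : barycentric y -> carrier y != finset.set0.
Proof.
move=> by_; apply/eqP => y0; have [_ /eqP] := by_.
rewrite big1 ?(eq_sym 0) ?oner_eq0// => v _.
by apply: barycentric_out => //; rewrite y0 inE.
Qed.

Lemma delta_row_inj : injective (delta_mx 0 : 'I_d -> 'rV[R]_d).
Proof.
move=> v w /matrixP/(_ 0 v); rewrite !mxE !eqxx /=.
by case: eqP => // _ /eqP; rewrite oner_eq0.
Qed.

Lemma mem_vertices s v : (delta_mx 0 v \in vertices s) = (v \in s).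
Proof. by rewrite in_fset (mem_map delta_row_inj) mem_enum. Qed.

Lemma verticesP s u :
  reflect (exists2 v, v \in s & u = delta_mx 0 v) (u \in vertices s).
Proof.
rewrite in_fset; apply: (iffP mapP) => -[v vs ->]; exists v => //;
  by move: vs; rewrite mem_enum.
Qed.

Lemma sum_vertices (V : nmodType) s (F : 'rV[R]_d -> V) :
  \sum_(u <- vertices s) F u = \sum_(v in s) F (delta_mx 0 v).
Proof.
rewrite (perm_big [seq delta_mx 0 v | v <- enum s]) /=; last first.
  apply: uniq_perm; first exact: fset_uniq.
    by rewrite (map_inj_uniq delta_row_inj) enum_uniq.
  by move=> u; rewrite in_fset.
by rewrite big_map big_enum.
Qed.

Lemma sum_vertices_coord s (c : 'rV[R]_d -> R) w :
  (\sum_(u <- vertices s) c u *: u) 0 w =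
  if w \in s then c (delta_mx 0 w) else 0.
Proof.
rewrite sum_vertices summxE.
under eq_bigr do rewrite !mxE eqxx /=.
case: ifP => ws; last first.
  rewrite big1 // => v vs.
  by case: eqP => [e|]; [rewrite e vs in ws|rewrite mulr0].
rewrite (bigD1 w) //= eqxx mulr1 big1 ?addr0 // => v /andP[_ vw].
by rewrite eq_sym (negPf vw) mulr0.
Qed.

Lemma convex_hull_vertices s :
  convex_hull (vertices s) = [set y | barycentric y /\ carrier y \subset s].
Proof.
apply/seteqP; split=> [y [c [c0 c1 yE]] | y [by_ ys]] /=.
  have cE w : y 0 w = if w \in s then c (delta_mx 0 w) else 0.
    by rewrite yE; exact: sum_vertices_coord.
  split; last first.
    apply/fintype.subsetP => v; rewrite mem_carrier cE; case: ifP => //.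
    by rewrite ltxx.
  split=> [v|].
    by rewrite cE; case: ifP => // vs; rewrite c0 ?mem_vertices.
  under eq_bigr do rewrite cE.
  by rewrite -big_mkcond /= -c1; apply/esym; exact: sum_vertices.
(* Weights must be a function of the vector, not of its index; this linear functional takes the
   value [y 0 v] at [delta_mx 0 v]. *)
pose c (u : 'rV[R]_d) := \sum_w u 0 w * y 0 w.
have cE v : c (delta_mx 0 v) = y 0 v.
  rewrite /c (bigD1 v) //= big1 ?addr0 ?mxE ?eqxx ?mul1r // => w /negPf wv.
  by rewrite mxE wv mul0r.
have out v : v \notin s -> y 0 v = 0.
  move=> vs; apply: barycentric_out => //; apply: contra vs.
  exact: (fintype.subsetP ys).
exists c; split.
- by move=> u /verticesP[v vs ->]; rewrite cE; case: by_.
- apply: etrans (sum_vertices _ _) _.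
  rewrite big_mkcond /= -by_.2; apply: eq_bigr => v _.
  by rewrite cE; case: ifPn => // /out ->.
- apply/rowP => v; apply/esym; apply: etrans (sum_vertices_coord _ _ _) _.
  by rewrite cE; case: ifPn => // /out.
Qed.

Lemma affinely_independent_vertices s : affinely_independent (vertices s).
Proof.
move=> c _ c0 u /verticesP[v vs ->].
have := sum_vertices_coord s c v; rewrite vs => <-.
by apply: etrans (congr1 (fun M : 'rV[R]_d => M 0 v) c0) _; rewrite mxE.
Qed.

Lemma vertices_eq0 s : (vertices s == fset0) = (s == finset.set0).
Proof.
apply/eqP/eqP => [s0|->].
  by apply/setP => v; rewrite -mem_vertices s0 !inE.
by apply/fsetP => u; apply/verticesP; rewrite inE => -[v]; rewrite inE.
Qed.

Lemma sub_vertices s (t : {fset 'rV[R]_d}) : (t `<=` vertices s)%fset ->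
  exists2 r : {set 'I_d}, r \subset s & t = vertices r.
Proof.
move=> /fsubsetP ts; exists [set v | delta_mx 0 v \in t]%SET.
  by apply/fintype.subsetP => v; rewrite inE => /ts; rewrite mem_vertices.
apply/fsetP => u; apply/idP/verticesP => [ut | [v + ->]]; last by rewrite inE.
by have /verticesP[v vs uE] := ts u ut; exists v => //; rewrite inE -uE.
Qed.

Definition simplices L : {fset {fset 'rV[R]_d}} :=
  [fset F in [seq vertices s | s <- enum L]]%fset.

Lemma simplicesP L F :
  reflect (exists2 s, s \in L & F = vertices s) (F \in simplices L).
Proof.
rewrite in_fset; apply: (iffP mapP) => -[s sL ->]; exists s => //;
  by move: sL; rewrite mem_enum.
Qed.

Lemma simplicial_complex_simplices L :
  abstract_complex L -> simplicial_complex (simplices L).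
Proof.
move=> [L0 Ls]; split.
- move=> _ /simplicesP[s sL ->]; rewrite vertices_eq0; split.
    by apply: contraNneq L0 => <-.
  exact: affinely_independent_vertices.
- move=> _ t /simplicesP[s sL ->] t0 /sub_vertices[r rs tE].
  apply/simplicesP; exists r => //; apply: Ls rs => //.
  by rewrite -vertices_eq0 -tE.
- move=> _ _ /simplicesP[s sL ->] /simplicesP[t tL ->].
  (* Barycentric coordinates in the standard simplex are unique, so two faces meet in the face on
     their common vertices. *)
  have hI : convex_hull (vertices s) `&` convex_hull (vertices t) =
            convex_hull (vertices (s :&: t)).
    rewrite !convex_hull_vertices; apply/seteqP.
    split=> y /= => [[[b ys] [_ yt]] | [b]]; first by rewrite finset.subsetI ys.
    by rewrite finset.subsetI => /andP[].
  case: (eqVneq (s :&: t)%SET finset.set0) => st0; [left|right].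
    rewrite hI st0 convex_hull_vertices; apply/seteqP; split=> // y [b].
    by rewrite finset.subset0 (negPf (carrier_neq0 b)).
  exists (vertices (s :&: t)); split=> //.
  + by rewrite vertices_eq0.
  + apply/fsubsetP => _ /verticesP[v + ->].
    by rewrite inE mem_vertices => /andP[].
  + apply/fsubsetP => _ /verticesP[v + ->].
    by rewrite inE mem_vertices => /andP[].
Qed.

Lemma underlying_space_simplices L :
  abstract_complex L -> underlying_space (simplices L) = realization L.
Proof.
move=> [L0 Ls]; apply/seteqP; split=> y /=.
  move=> [_ /simplicesP[s sL ->]]; rewrite convex_hull_vertices => -[b ys].
  by split=> //; apply: Ls sL _ ys; exact: carrier_neq0.
move=> [b yL]; exists (vertices (carrier y)).
  by apply/simplicesP; exists (carrier y).
by rewrite convex_hull_vertices.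
Qed.

Lemma polyhedron_realization L :
  abstract_complex L -> polyhedron (set_type (realization L) : metricType R).
Proof.
move=> cL; exists d, (simplices L); split.
  exact: simplicial_complex_simplices.
rewrite underlying_space_simplices//.
by exists idfun, idfun; split=> // x; exact: cvg_id.
Qed.

End Realization.

(** * Irreducible maps onto polyhedra *)

Section Continuity.
Variables (R : realType) (T : topologicalType).

Lemma continuous_row d (F : T -> 'rV[R]_d) :
  (forall v, continuous (fun x => F x 0 v)) -> continuous F.
Proof.
move=> cF x A [B /= nB BA].
have : \forall z \near x, forall v, B 0 v (F z 0 v).
  by apply: filter_forall => v; exact: cF (nB 0 v).
by apply: filterS => z FB; apply: BA => i v; rewrite ord1; exact: FB.
Qed.

Lemma continuous_coord d (F : T -> 'rV[R]_d) v :
  continuous F -> continuous (fun x => F x 0 v).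
Proof.
move=> cF x; apply: (@continuous_comp _ _ _ F (fun M : 'rV[R]_d => M 0 v)).
  exact: cF.
exact: coord_continuous.
Qed.

Lemma continuous_sumr (I : finType) (F : I -> T -> R) :
  (forall i, continuous (F i)) -> continuous (fun x => \sum_i F i x).
Proof.
move=> cF; apply: (@continuous_big R^o _ +%R) => // x.
exact: (@add_continuous R^o).
Qed.

End Continuity.

Lemma mdist_continuous (R : realType) (X : metricType R) (c : X) :
  continuous (fun x => mdist c x : R^o).
Proof.
move=> x; apply/cvgrPdist_lt => e e0; near=> y.
have xy : mdist x y < e by near: y; apply: cvgr_dist_lt; [exact: cvg_id|].
change (`|mdist c y - mdist c x| < e); rewrite ltr_norml; apply/andP; split.
  have := metric_triangle c y x; rewrite (metric_sym y x). lra.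
have := metric_triangle c x y; lra.
Unshelve. all: by end_near. Qed.

Lemma compact_finite_net (R : realType) (X : metricType R) (e : R) (x0 : X) :
  compact [set: X] -> 0 < e ->
  exists (d : nat) (c : 'I_d -> X), forall x, exists v, mdist (c v) x < e.
Proof.
move=> cX e0.
pose Xp : ptopologicalType :=
  HB.pack (X : Type) (Topological.class X) (isPointed.Build (X : Type) x0).
have : @cover_compact Xp setT by rewrite -(compact_cover Xp).
move=> /(_ X setT (fun c => interior (ball c e)))[]//.
- by move=> c _; exact: open_interior.
- by move=> x _; exists x => //; exact: nbhsx_ballx.
move=> N _ cN; exists (size N), (fun v => nth x0 N v) => x.
have [c /= cN' xc] := cN x I.
have iN : (index c N < size N)%N by rewrite index_mem.
exists (Ordinal iN); rewrite /= nth_index//.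
by have := interior_subset xc; rewrite ballEmdist.
Qed.

Section IrreducibleMaps.
Variables (R : realType) (X : topologicalType).

Lemma barycentric_eq d (y z : 'rV[R]_d) : barycentric y -> barycentric z ->
  (forall v, y 0 v <= z 0 v) -> z = y.
Proof.
move=> [_ y1] [_ z1] yz; apply/rowP => v; apply/eqP; rewrite -subr_eq0.
have : \sum_v (z 0 v - y 0 v) == 0 by rewrite sumrB y1 z1 subrr.
rewrite psumr_eq0 => [|w _]; last by rewrite subr_ge0.
by move=> /allP/(_ v); rewrite mem_index_enum => /(_ isT).
Qed.

(* Radial projection from [y]: subtracting from [z] the largest multiple of [y]
   that keeps the coordinates nonnegative, and renormalizing, makes some
   coordinate of the carrier of [y] vanish. *)
Lemma push_off d (phi : X -> 'rV[R]_d) (y : 'rV[R]_d) :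
  continuous phi -> (forall x, barycentric (phi x)) -> barycentric y ->
  (forall x, phi x <> y) ->
  exists2 phi' : X -> 'rV[R]_d, continuous phi' &
    forall x, [/\ barycentric (phi' x), carrier (phi' x) \subset carrier (phi x)
      & ~~ (carrier y \subset carrier (phi' x))].
Proof.
move=> cphi bphi by_ miss.
pose m x := \big[Num.min/1]_(v in carrier y) (phi x 0 v / y 0 v).
have ypos v : v \in carrier y -> 0 < y 0 v by rewrite inE.
have mle x v : m x * y 0 v <= phi x 0 v.
  have [vy|vy] := boolP (v \in carrier y).
    by rewrite -ler_pdivlMr ?ypos//; exact: bigmin_le_cond.
  by rewrite (barycentric_out by_ vy) mulr0; case: (bphi x).
have m0 x : 0 <= m x.
  apply: le_bigmin => // v vy; rewrite divr_ge0 ?(ltW (ypos _ vy))//.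
  by case: (bphi x).
(* If [m x] were 1, [phi x] would dominate [y] in every coordinate, hence equal [y], as both have
   coordinate sum 1. *)
have m1 x : m x < 1.
  rewrite lt_neqAle bigmin_le_id andbT; apply/eqP => mx1; apply: (miss x).
  by apply: barycentric_eq => // v; rewrite -[leLHS]mul1r -mx1.
have d0 x : 0 < 1 - m x by rewrite subr_gt0.
have cm : continuous m.
  rewrite /m; apply: (@continuous_big R^o _ Num.min) => [|v vy].
    exact: min_continuous.
  move=> x; apply: cvgM; last exact: cvg_cst.
  exact: continuous_coord.
exists (fun x => \row_v ((phi x 0 v - m x * y 0 v) / (1 - m x))).
  apply: continuous_row => v.
  under eq_fun do rewrite mxE.
  move=> x; apply: cvgM.
    apply: cvgB; first exact: continuous_coord.
    by apply: cvgM; [exact: cm|exact: cvg_cst].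
  apply: cvgV; first by rewrite gt_eqF.
  by apply: cvgB; [exact: cvg_cst|exact: cm].
move=> x; split.
- split=> [v|]; first by rewrite mxE divr_ge0 ?(ltW (d0 x))// subr_ge0.
  under eq_bigr do rewrite mxE.
  rewrite -mulr_suml sumrB -mulr_sumr by_.2 (bphi x).2 mulr1 divff//.
  by rewrite gt_eqF.
- apply/fintype.subsetP => v; rewrite !inE mxE pmulr_lgt0 ?invr_gt0// subr_gt0.
  by apply: le_lt_trans; rewrite mulr_ge0//; case: by_.
(* If all of [carrier y] survived, every quotient in the minimum, as well as the cap 1, would exceed
   [m x]. *)
- apply/negP => /fintype.subsetP ys; suff : m x < m x by rewrite ltxx.
  apply/bigmin_gtP; split=> // v vy.
  have := ys v vy; rewrite inE mxE pmulr_lgt0 ?invr_gt0// subr_gt0 => h.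
  by rewrite ltr_pdivlMr ?ypos.
Qed.

Definition irreducible d (L : {set {set 'I_d}}) (phi : X -> 'rV[R]_d) : Prop :=
  forall phi' : X -> 'rV[R]_d, continuous phi' ->
    (forall x, barycentric (phi' x) /\
      carrier (phi' x) \subset carrier (phi x)) ->
    forall y, realization L y -> exists x, phi' x = y.

(** Induction on the number of simplices. Carriers only shrink on the way, so smallness of the
    preimages of stars is inherited. *)
Lemma exists_irreducible d (L : {set {set 'I_d}}) (phi : X -> 'rV[R]_d) :
  abstract_complex L -> continuous phi -> (forall x, realization L (phi x)) ->
  exists (L' : {set {set 'I_d}}) (phi' : X -> 'rV[R]_d),
    [/\ abstract_complex L', continuous phi', forall x, realization L' (phi' x),
      forall x, carrier (phi' x) \subset carrier (phi x) & irreducible L' phi'].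
Proof.
have [n] := ubnP #|L|; elim: n L phi => // n IHn L phi Ln cL cphi Lphi.
have [irr|] := pselect (irreducible L phi).
  by exists L, phi; split.
move=> /existsNP[psi] /not_implyP[cpsi] /not_implyP[psiP].
move=> /existsNP[y] /not_implyP[[by_ yL]] /forallNP miss.
have [chi cchi chiP] := push_off cpsi (fun x => (psiP x).1) by_ miss.
have chi_sub x : carrier (chi x) \subset carrier (phi x).
  have [_ s _] := chiP x; exact: fintype.subset_trans s (psiP x).2.
(* What remains after deleting the open star of [carrier y]; at least [carrier y] itself is lost. *)
pose L1 := [set s in L | ~~ (carrier y \subset s)]%SET.
have L1L : (#|L1| < #|L|)%N.
  apply: proper_card; apply/properP; split.
    by apply/fintype.subsetP => s; rewrite inE => /andP[].
  by exists (carrier y) => //; rewrite inE subxx andbF.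
have cL1 : abstract_complex L1.
  case: cL => L0 Ls; split; first by rewrite inE (negPf L0).
  move=> s t; rewrite !inE => /andP[sL ys] t0 ts; rewrite (Ls s t)//=.
  by apply: contra ys => /fintype.subset_trans; exact.
have L1chi x : realization L1 (chi x).
  have [b s ny] := chiP x; split=> //; rewrite inE ny andbT.
  by apply: (cL.2 _ _ (Lphi x).2) => //; exact: carrier_neq0.
have [L' [psi' [cL' cpsi' L'psi' psi'_sub irr]]] :=
  IHn L1 chi (leq_trans L1L Ln) cL1 cchi L1chi.
exists L', psi'; split=> // x.
exact: fintype.subset_trans (psi'_sub x) (chi_sub x).
Qed.

End IrreducibleMaps.

(** Normalized bumps of radius [e / 2] around a finite net: two points that share a vertex are both
    within [e / 2] of its center. *)
Lemma exists_small_irreducible (R : realType) (X : metricType R) (e : R)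
    (x0 : X) :
  compact [set: X] -> 0 < e ->
  exists (d : nat) (L : {set {set 'I_d}}) (phi : X -> 'rV[R]_d),
    [/\ abstract_complex L, continuous phi, forall x, realization L (phi x),
      forall x y v, v \in carrier (phi x) -> v \in carrier (phi y) ->
        mdist x y < e & irreducible L phi].
Proof.
move=> cX e0; have e20 : 0 < e / 2 by rewrite divr_gt0.
have [d [c cP]] := compact_finite_net x0 cX e20.
pose bump v x : R := Num.max 0 (e / 2 - mdist (c v) x).
have bump_ge0 v x : 0 <= bump v x by rewrite le_max lexx.
have bump_gt0 v x : (0 < bump v x) = (mdist (c v) x < e / 2).
  by rewrite lt_max ltxx subr_gt0.
have cbump v : continuous (bump v).
  move=> x; apply: (@continuous_max R X (fun=> 0)); first exact: cvg_cst.
  by apply: cvgB; [exact: cvg_cst|exact: mdist_continuous].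
pose total x := \sum_v bump v x.
have total_gt0 x : 0 < total x.
  have [v vx] := cP x; rewrite /total (bigD1 v)//= ltr_pwDl ?bump_gt0//.
  exact: sumr_ge0.
pose phi x : 'rV[R]_d := \row_v (bump v x / total x).
have phi_carrier x v : (v \in carrier (phi x)) = (mdist (c v) x < e / 2).
  by rewrite inE mxE pmulr_lgt0 ?invr_gt0.
have bphi x : barycentric (phi x).
  split=> [v|]; first by rewrite mxE divr_ge0// ltW.
  under eq_bigr do rewrite mxE.
  by rewrite -mulr_suml -/(total x) divff// gt_eqF.
(* The full simplex serves as the initial complex; [exists_irreducible] cuts it down. *)
pose L0 := [set s : {set 'I_d} | s != finset.set0]%SET.
have cL0 : abstract_complex L0.
  by split=> [|s t _ t0 _]; rewrite inE ?eqxx.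
have cphi : continuous phi.
  apply: continuous_row => v; under eq_fun do rewrite mxE.
  move=> x; apply: cvgM; first exact: cbump.
  apply: cvgV; first by rewrite gt_eqF.
  by apply: continuous_sumr => w; exact: cbump.
have [|L [psi [cL cpsi Lpsi psi_sub irr]]] := exists_irreducible cL0 cphi.
  by move=> x; split; rewrite // inE carrier_neq0.
exists d, L, psi; split=> // x y v.
move=> /(fintype.subsetP (psi_sub x)) + /(fintype.subsetP (psi_sub y)).
rewrite !phi_carrier => vx vy.
have := metric_triangle x (c v) y; rewrite (metric_sym x (c v)); lra.
Qed.

(** * Bonding maps *)

Section Collapse.
Variables (R : realType) (d : nat) (eta : R).
Hypotheses (eta_ge0 : 0 <= eta) (eta_small : d%:R * eta <= 1 / 2).
Implicit Types y z : 'rV[R]_d.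

Let cut y v : R := Num.max 0 (y 0 v - eta).

Definition collapse y : 'rV[R]_d := \row_v (cut y v / \sum_w cut y w).

Let cut_ge0 y v : 0 <= cut y v.
Proof. by rewrite le_max lexx. Qed.

(** The mass cut off is at most [d%:R * eta], hence at most one half. *)
Let sum_cut y : barycentric y -> 1 / 2 <= \sum_v cut y v <= 1.
Proof.
move=> [y0 y1]; apply/andP; split.
  rewrite (@le_trans _ _ (\sum_v (y 0 v - eta)))//; last first.
    by apply: ler_sum => v _; rewrite le_max lexx orbT.
  rewrite sumrB y1 sumr_const card_ord -[eta *+ d]mulr_natl.
  by move: eta_small; lra.
rewrite -[leRHS]y1; apply: ler_sum => v _; rewrite ge_max y0/=.
by rewrite lerBlDr lerDl.
Qed.

Let sum_cut_gt0 y : barycentric y -> 0 < \sum_v cut y v.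
Proof. by move=> /sum_cut /andP[h _]; rewrite (lt_le_trans _ h). Qed.

Lemma barycentric_collapse y : barycentric y -> barycentric (collapse y).
Proof.
move=> by_; have S0 := sum_cut_gt0 by_; split=> [v|].
  by rewrite mxE divr_ge0// ltW.
under eq_bigr do rewrite mxE.
by rewrite -mulr_suml divff// gt_eqF.
Qed.

(* With [z] in a subcomplex, this brings points near it back into it. *)
Lemma carrier_collapse y z : barycentric y -> barycentric z ->
  (forall v, `|y 0 v - z 0 v| <= eta) -> carrier (collapse y) \subset carrier z.
Proof.
move=> by_ bz yz; apply/fintype.subsetP => v; rewrite inE mxE => cv.
have : 0 < cut y v by move: cv; rewrite pmulr_lgt0 ?invr_gt0 ?sum_cut_gt0.
rewrite lt_max ltxx /= => yv; rewrite mem_carrier.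
by have := yz v; rewrite ler_norml => /andP[]; lra.
Qed.

(** With [S] the remaining mass and [q] the new coordinate, [q = q * S + q * (1 - S)]. The first
    term is the cut coordinate, within [eta] of the old one; the second is at most [2 * d%:R * eta],
    since [q <= 2]. *)
Lemma collapse_dist y v : barycentric y ->
  `|collapse y 0 v - y 0 v| <= 2 * d%:R * eta.
Proof.
move=> by_; have /andP[S1 S2] := sum_cut by_.
have S0 := sum_cut_gt0 by_; have [y0 y1] := by_.
(* The index [v] shows that [d] is positive, which gives [eta <= d%:R * eta] below. *)
have d1 : 1 <= d%:R :> R by rewrite ler1n; case: (d) v => // -[].
have y_le1 : y 0 v <= 1.
  by rewrite -y1 (bigD1 v)//= lerDl sumr_ge0.
have cutl : y 0 v - eta <= cut y v by rewrite le_max lexx orbT.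
have cutr : cut y v <= y 0 v by rewrite ge_max y0/= lerBlDr lerDl.
have Sl : 1 - d%:R * eta <= \sum_w cut y w.
  rewrite (@le_trans _ _ (\sum_v (y 0 v - eta)))//; last first.
    by apply: ler_sum => w _; rewrite le_max lexx orbT.
  by rewrite sumrB y1 sumr_const card_ord -[eta *+ d]mulr_natl.
rewrite mxE; set S := \sum_w cut y w in S0 S1 S2 Sl *.
set q := cut y v / S; have qS : q * S = cut y v by rewrite divfK// gt_eqF.
have q0 : 0 <= q by rewrite divr_ge0// ltW.
have eta_d : eta <= d%:R * eta by rewrite ler_peMl.
have qS' : q * S <= q by rewrite ler_piMr.
have q_le : q * (1 - d%:R * eta) <= q * S by rewrite ler_wpM2l.
have q2 : q <= 2.
  have : q * (1 / 2) <= q * S by rewrite ler_wpM2l.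
  lra.
have : q * (d%:R * eta) <= 2 * (d%:R * eta).
  by rewrite ler_wpM2r// mulr_ge0.
by rewrite ler_norml; move=> h; apply/andP; split; lra.
Qed.

End Collapse.

Lemma collapse_continuous (R : realType) d (eta : R) (T : topologicalType)
    (F : T -> 'rV[R]_d) : 0 <= eta -> d%:R * eta <= 1 / 2 ->
  continuous F -> (forall x, barycentric (F x)) ->
  continuous (fun x => collapse eta (F x)).
Proof.
move=> eta0 etad cF bF.
have ccut v : continuous (fun x => Num.max 0 (F x 0 v - eta)).
  move=> x; apply: (@continuous_max R T (fun=> 0)); first exact: cvg_cst.
  by apply: cvgB; [exact: continuous_coord|exact: cvg_cst].
apply: continuous_row => v; under eq_fun do rewrite mxE.
move=> x; apply: cvgM; first exact: ccut.
apply: cvgV; last by apply: continuous_sumr => w; exact: ccut.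
(* A zero denominator would make every coordinate of the collapse 0, as [0^-1 = 0], against their
   sum being 1. *)
have [_ b1] := barycentric_collapse eta0 etad (bF x).
apply/eqP => S0; move/eqP: b1; rewrite big1 ?(eq_sym 0) ?oner_eq0// => w _.
by rewrite mxE S0 invr0 mulr0.
Qed.

Section Bonding.
Variables (R : realType) (X : metricType R).
Hypothesis compactX : compact [set: X].
Variable x0 : X.

Definition polytope d (L : {set {set 'I_d}}) : metricType R :=
  set_type (@realization R d L).

(** The third condition bounds the preimages of open stars of vertices. *)
Definition approximation (e : R) d (L : {set {set 'I_d}})
    (phi : X -> polytope L) : Prop :=
  [/\ abstract_complex L, continuous phi,
    forall x y v, v \in carrier (set_val (phi x)) ->
      v \in carrier (set_val (phi y)) -> mdist x y < e
    & irreducible L (set_val \o phi)].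

Lemma polytopeP d (L : {set {set 'I_d}}) (y : polytope L) :
  realization L (set_val y).
Proof. exact: (set_mem (valP y)). Qed.

Lemma continuous_set_val d (L : {set {set 'I_d}}) :
  continuous (set_val : polytope L -> 'rV[R]_d).
Proof. exact: initial_continuous. Qed.

(** [phi] is itself one of the maps that shrink its carriers. *)
Lemma approximation_surj e d (L : {set {set 'I_d}}) (phi : X -> polytope L) :
  approximation e phi -> forall y, exists x, phi x = y.
Proof.
move=> [_ cphi _ irr] y.
have [||x xy] := irr (set_val \o phi) _ _ _ (polytopeP y).
- by move=> x; apply: continuous_comp; [exact: cphi|exact: continuous_set_val].
- by move=> x; split=> //; case: (polytopeP (phi x)).
- by exists x; apply: val_inj.
Qed.

Lemma approximation_compact e d (L : {set {set 'I_d}}) (phi : X -> polytope L) :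
  approximation e phi -> compact [set: polytope L].
Proof.
move=> aphi; rewrite (_ : setT = range phi).
  by apply: continuous_compact => //; apply: continuous_subspaceT; case: aphi.
apply/seteqP; split=> // y _.
by have [x <-] := approximation_surj aphi y; exists x.
Qed.

Lemma coord_le_mdist d (L : {set {set 'I_d}}) (y z : polytope L) v :
  `|set_val y 0 v - set_val z 0 v| <= mdist y z.
Proof.
change (`|set_val y 0 v - set_val z 0 v| <= `|set_val y - set_val z|).
have := le_bigmax 0 (fun i => `|(set_val y - set_val z) i.1 i.2|) (0, v).
by rewrite -mx_normrE !mxE.
Qed.

(** [delta] is fixed before [phi'], so any fine enough approximation can be the next stage. The last
    two conclusions supply [psi_step] and [D_small]. *)
Lemma exists_bonding (d : nat) (L : {set {set 'I_d}}) (phi : X -> polytope L)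
    (e kappa : R) : approximation e phi -> 0 < kappa ->
  exists2 delta : R, 0 < delta & forall e' d' (L' : {set {set 'I_d'}})
    (phi' : X -> polytope L'), e' <= delta -> approximation e' phi' ->
    exists f : polytope L' -> polytope L,
      [/\ continuous f, forall y, exists z, f z = y,
        forall a b, f (phi' a) = phi b -> mdist a b < e
      & forall a b, mdist a b <= 4 * e' ->
          mdist (f (phi' a)) (f (phi' b)) < kappa].
Proof.
move=> aphi kappa0; have [cL cphi ephi irr] := aphi.
have d10 : 0 < (2 * d%:R + 1) :> R by rewrite ltr_pwDr// mulr_ge0.
(* The affine map errs by at most [eta] and the collapse by [2 * d%:R * eta], together at most
   [kappa / 8]; the bound 1/2 is what the collapse requires. *)
pose eta := Num.min (kappa / 8) (1 / 2) / (2 * d%:R + 1).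
have eta0 : 0 < eta by rewrite divr_gt0// lt_min !divr_gt0.
have etaE : (2 * d%:R + 1) * eta = Num.min (kappa / 8) (1 / 2).
  by rewrite mulrC divfK// gt_eqF.
have eta_kappa : (2 * d%:R + 1) * eta <= kappa / 8.
  by rewrite etaE ge_min lexx.
have eta_half : d%:R * eta <= 1 / 2.
  have : (2 * d%:R + 1) * eta <= 1 / 2 by rewrite etaE ge_min lexx orbT.
  have : 0 <= d%:R * eta by rewrite mulr_ge0// ltW.
  lra.
have [delta delta0 deltaP] := compact_unif_continuous compactX cphi
  (ltac:(by rewrite lt_min eta0 divr_gt0) : 0 < Num.min eta (kappa / 2)).
(* The factor 5 makes even [4 * e'] smaller than [delta]. *)
exists (delta / 5) => [|e' d' L' phi' e'd aphi']; first by rewrite divr_gt0.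
have [_ cphi' ephi' _] := aphi'.
have [p pP] : {p : 'I_d' -> X & forall w a,
    w \in carrier (set_val (phi' a)) -> w \in carrier (set_val (phi' (p w)))}.
  apply: (@choice _ _ (fun w pw => forall a, w \in carrier (set_val (phi' a)) ->
    w \in carrier (set_val (phi' pw)))) => w.
  have [[a aw]|noa] := pselect (exists a, w \in carrier (set_val (phi' a))).
    by exists a.
  (* Default for an index [w] in no carrier, whose weight is always 0. *)
  by exists x0 => a aw; exfalso; apply: noa; exists a.
pose g (y : polytope L') : 'rV[R]_d :=
  \row_v \sum_w set_val y 0 w * set_val (phi (p w)) 0 v.
have bg y : barycentric (g y).
  have [[y0 y1] _] := polytopeP y; split=> [v|].
    rewrite mxE sumr_ge0// => w _; rewrite mulr_ge0//.
    by have [[]] := polytopeP (phi (p w)).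
  under eq_bigr do rewrite mxE.
  rewrite exchange_big -[RHS]y1; apply: eq_bigr => w _ /=.
  by have [[_ z1] _] := polytopeP (phi (p w)); rewrite -mulr_sumr z1 mulr1.
have cg : continuous g.
  apply: continuous_row => v; under eq_fun do rewrite mxE.
  apply: continuous_sumr => w y.
  apply: (@continuousM R _ (fun z : polytope L' => set_val z 0 w)
    (fun=> set_val (phi (p w)) 0 v)); last exact: cst_continuous.
  by apply: continuous_coord; exact: continuous_set_val.
(* [g (phi' a)] averages the points [phi (p w)] over [w] in the carrier of [phi' a], and each such
   [p w] shares the star of [w] with [a]. *)
have g_near a v : `|g (phi' a) 0 v - set_val (phi a) 0 v| <= eta.
  have [[y0 y1] _] := polytopeP (phi' a).
  have -> : g (phi' a) 0 v - set_val (phi a) 0 v = \sum_w set_val (phi' a) 0 w *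
      (set_val (phi (p w)) 0 v - set_val (phi a) 0 v).
    rewrite mxE; under [RHS]eq_bigr do rewrite mulrBr.
    by rewrite sumrB -mulr_suml y1 mul1r.
  rewrite (le_trans (ler_norm_sum _ _ _))// -[eta]mul1r -y1 mulr_suml.
  apply: ler_sum => w _; rewrite normrM (ger0_norm (y0 w)).
  have [wa|wa] := boolP (w \in carrier (set_val (phi' a))); last first.
    by rewrite (barycentric_out _ wa)// !mul0r.
  rewrite ler_wpM2l// (le_trans (coord_le_mdist _ _ _))//.
  have /deltaP : mdist (p w) a < delta.
    by have := ephi' _ _ _ (pP _ _ wa) wa; lra.
  by rewrite lt_min => /andP[/ltW].
have h_carrier a : carrier (collapse eta (g (phi' a))) \subset
    carrier (set_val (phi a)).
  apply: carrier_collapse => //; first exact: ltW.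
  by case: (polytopeP (phi a)).
have hL y : realization L (collapse eta (g y)).
  have [a <-] := approximation_surj aphi' y.
  have b := barycentric_collapse (ltW eta0) eta_half (bg (phi' a)).
  split=> //; apply: (cL.2 _ _ (polytopeP (phi a)).2) => //.
  exact: carrier_neq0.
have ch : continuous (fun y => collapse eta (g y)).
  exact: collapse_continuous (ltW eta0) eta_half cg bg.
pose f (y : polytope L') : polytope L :=
  exist _ (collapse eta (g y)) (mem_set (hL y)).
have f_near a v :
    `|set_val (f (phi' a)) 0 v - set_val (phi a) 0 v| <= kappa / 8.
  have h1 := collapse_dist (ltW eta0) eta_half v (bg (phi' a)).
  have := ler_distD (g (phi' a) 0 v) (collapse eta (g (phi' a)) 0 v)
    (set_val (phi a) 0 v).
  have h2 := g_near a v; move: h1 h2 eta_kappa.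
  by rewrite mulrDl mul1r /f set_valE /=; lra.
exists f; split.
- exact: continuous_comp_initial.
- move=> y; have [||x xy] :=
    irr (fun x => collapse eta (g (phi' x))) _ _ _ (polytopeP y).
  + by move=> x; exact: continuous_comp (cphi' x) (ch _).
  + by move=> x; split; [case: (hL (phi' x))|exact: h_carrier].
  + by exists (phi' x); apply: val_inj.
(* A vertex of [phi b = f (phi' a)] is also a vertex of [phi a], so [a] and [b] lie in the preimage
   of one star. *)
- move=> a b fab; have b0 : carrier (set_val (phi b)) != finset.set0.
    by apply: carrier_neq0; case: (polytopeP (phi b)).
  have /set0Pn[v vb] := b0; apply: (ephi a b v) => //.
  by apply: (fintype.subsetP (h_carrier a)); rewrite -fab in vb.
- move=> a b ab; have /deltaP : mdist a b < delta by lra.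
  rewrite lt_min => /andP[_ ab2].
  change (mx_norm (set_val (f (phi' a)) - set_val (f (phi' b))) < kappa).
  rewrite mx_normrE; apply/bigmax_ltP; split=> // -[u v] _ /=.
  rewrite (ord1 u) mxE [X in _ + X]mxE.
  have := f_near a v; have := f_near b v.
  have := coord_le_mdist (phi a) (phi b) v.
  rewrite !ler_norml ltr_norml => /andP[? ?] /andP[? ?] /andP[? ?].
  by apply/andP; split; lra.
Qed.

End Bonding.

(** * Continua as inverse limits of polyhedra *)

Section Freudenthal.
Variables (R : realType) (X : metricType R).
Hypothesis compactX : compact [set: X].
Variable x0 : X.

Lemma polytope_near e d (L : {set {set 'I_d}}) (phi : X -> polytope R L) :
  approximation e phi -> forall y, exists2 N, nbhs y N &
    forall a b, phi a = y -> N (phi b) -> mdist a b < e.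
Proof.
move=> [_ _ ephi _] y.
have /set0Pn[v] : carrier (set_val y) != finset.set0.
  by apply: carrier_neq0; case: (polytopeP y).
(* Within this radius the coordinate [v] stays positive. *)
rewrite mem_carrier => yv; exists (ball y (set_val y 0 v)).
  exact: nbhsx_ballx.
move=> a b ay; rewrite ballEmdist /= => yb; apply: (ephi a b v).
  by rewrite ay mem_carrier.
have := coord_le_mdist y (phi b) v.
by rewrite mem_carrier ler_norml => /andP[_]; lra.
Qed.

(* [sdist] dominates the distances between the images in all earlier stages. *)
Record stage := Stage {
  sdim : nat;
  scomplex : {set {set 'I_sdim}};
  smesh : R;
  smap : X -> polytope R scomplex;
  sdist : polytope R scomplex -> polytope R scomplex -> R }.

Definition valid_stage (s : stage) : Prop :=
  [/\ approximation (smesh s) (smap s), 0 < smesh s,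
    forall y z : polytope R (scomplex s), 0 <= sdist y z,
    forall y z : polytope R (scomplex s), sdist y z <= 0 -> y = z
    & forall e : R, 0 < e -> exists2 delta : R, 0 < delta &
        forall y z : polytope R (scomplex s),
          mdist y z < delta -> sdist y z < e].

Definition stage_bonding (s s' : stage)
    (f : polytope R (scomplex s') -> polytope R (scomplex s)) : Prop :=
  [/\ continuous f, forall y, exists z, f z = y,
    forall a b, f (smap s' a) = smap s b -> mdist a b < smesh s,
    forall a b, mdist a b <= 4 * smesh s' ->
      sdist (f (smap s' a)) (f (smap s' b)) <= smesh s
    & forall y z, sdist (f y) (f z) <= sdist y z].

Lemma exists_approximation (e : R) : 0 < e ->
  exists (d : nat) (L : {set {set 'I_d}}) (phi : X -> polytope R L),
    approximation e phi.
Proof.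
move=> e0.
have [d [L [phi [cL cphi Lphi ephi irr]]]] :=
  exists_small_irreducible x0 compactX e0.
exists d, L, (fun x => exist _ (phi x) (mem_set (Lphi x))); split=> //.
exact: continuous_comp_initial.
Qed.

Lemma first_stage (e : R) : 0 < e -> exists2 s, valid_stage s & smesh s = e.
Proof.
move=> e0; have [d [L [phi aphi]]] := exists_approximation e0.
exists (@Stage d L e phi (@mdist R _)) => //; split=> //=.
- exact: mdist_ge0.
- move=> y z yz; apply: mdist_positivity; apply/eqP.
  by rewrite eq_le yz mdist_ge0.
- by move=> e' e'0; exists e'.
Qed.

Lemma next_stage (s : stage) : valid_stage s ->
  exists s', [/\ valid_stage s', smesh s' <= smesh s / 2
    & exists f, stage_bonding (s:=s) (s':=s') f].
Proof.
case: s => d L e phi D [/= aphi e0 D0 Dpos Dcont].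
(* Closeness below [kappa] gives [D] below [e], turning the last conclusion of [exists_bonding] into
   a bound on [sdist]. *)
have [kappa kappa0 Dkappa] := Dcont e e0.
have [delta delta0 fP] := exists_bonding compactX x0 aphi kappa0.
pose e' := Num.min delta (e / 2).
have e'0 : 0 < e' by rewrite lt_min delta0 divr_gt0.
have [d' [L' [phi' aphi']]] := exists_approximation e'0.
have [|f [cf sf fB fC]] := fP e' d' L' phi' _ aphi'.
  by rewrite ge_min lexx.
(* The summand [mdist y z] separates points; the summand [D (f y) (f z)] makes [f] nonexpanding for
   the two [sdist]s. *)
exists (@Stage d' L' e' phi' (fun y z => mdist y z + D (f y) (f z))).
split=> /=.
- split=> //=.
  + by move=> y z; rewrite addr_ge0// mdist_ge0.
  + move=> y z yz; apply: mdist_positivity; apply/eqP.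
    by rewrite eq_le mdist_ge0 andbT (le_trans _ yz)// lerDl.
  + move=> a a0; have a20 : 0 < a / 2 by rewrite divr_gt0.
    have [r r0 Dr] := Dcont _ a20.
    have cL' := approximation_compact compactX aphi'.
    have [q q0 fq] := compact_unif_continuous cL' cf r0.
    exists (Num.min q (a / 2)) => [|y z]; first by rewrite lt_min q0.
    by rewrite lt_min => /andP[/fq/Dr ? ?]; rewrite [ltRHS]splitr ltrD.
- by rewrite ge_min lexx orbT.
exists f; split=> //= [a b ab|y z]; first by rewrite ltW// Dkappa// fC.
by rewrite lerDr mdist_ge0.
Qed.

Theorem freudenthal (e : R) : connected [set: X] -> 0 < e ->
  exists (P : nat -> metricType R) (f : forall l, P l.+1 -> P l),
    [/\ forall l, polyhedron (P l) /\ connected [set: P l],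
      forall l, continuous (f l) /\ range (f l) = [set: P l]
      & exists (Phi : inverse_limit f -> X) (k : X -> inverse_limit f),
        [/\ continuous Phi, continuous k, cancel Phi k, cancel k Phi
          & forall n y z, projection n y = projection n z ->
              mdist (Phi y) (Phi z) <= e]].
Proof.
(* Threads with equal [n]-th coordinate share a lift, and each image is within twice the mesh, at
   most [e / 2], of it. *)
move=> conX e0; have e40 : 0 < e / 4 by rewrite divr_gt0.
have [s0 vs0 s0e] := first_stage e40.
have [next nextP] : {next : stage -> stage & forall s, valid_stage s ->
    [/\ valid_stage (next s), smesh (next s) <= smesh s / 2
      & exists f, stage_bonding (s:=s) (s':=next s) f]}.
  apply: (@choice _ _ (fun s s' => valid_stage s -> [/\ valid_stage s',
      smesh s' <= smesh s / 2
      & exists f, stage_bonding (s:=s) (s':=s') f])) => s.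
  have [/next_stage[s' ?]|] := pselect (valid_stage s); first by exists s'.
  by exists s.
pose st n := iter n next s0.
have vst n : valid_stage (st n) by elim: n => //= n /nextP[].
pose P n := polytope R (scomplex (st n)).
have exf n : exists f : P n.+1 -> P n, stage_bonding (s:=st n) (s':=st n.+1) f.
  by have [_ _] := nextP _ (vst n).
pose f n : P n.+1 -> P n := sval (cid (exf n)).
have fP n : stage_bonding (f n) by rewrite /f; case: cid.
have aP n : approximation (smesh (st n)) (smap (st n)) by case: (vst n).
have mesh_half n : smesh (st n.+1) <= smesh (st n) / 2.
  by have [_ +] := nextP _ (vst n).
have mesh_gt0 n : 0 < smesh (st n) by case: (vst n).
have mesh_le n : smesh (st n) <= e / 4.
  elim: n => [|n IHn]; first by rewrite /= s0e.
  by have := mesh_half n; have := mesh_gt0 n; lra.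
have cP n : compact [set: P n] := approximation_compact compactX (aP n).
have cf n : continuous (f n) by case: (fP n).
have sf n (y : P n) : exists z, f n z = y by case: (fP n).
have [Phi [k [cPhi ck Phik kPhi tr]]] : exists (Phi : inverse_limit f -> X) k,
    [/\ continuous Phi, continuous k, cancel Phi k, cancel k Phi
      & forall y,
          traced (fun n => smap (st n)) (fun n => smesh (st n)) y (Phi y)].
  apply: (inverse_limit_homeomorphic (D := fun n => @sdist (st n))) => //.
  - by move=> n; exact: approximation_surj (aP n).
  - by move=> n; exact: polytope_near (aP n).
  - by move=> n a b; case: (fP n) => _ _ + _ _; apply.
  - by move=> n y z; case: (fP n).
  - by move=> n y z; case: (vst n) => _ _ _ + _; apply.
  - by move=> n a b; case: (fP n) => _ _ _ + _; apply.
exists P, f; split.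
- move=> n; split; first by apply: polyhedron_realization; case: (aP n).
  rewrite (_ : setT = range (smap (st n))).
    apply: connected_continuous_connected => //.
    by apply: continuous_subspaceT; case: (aP n).
  apply/seteqP; split=> // y _; have [x <-] := approximation_surj (aP n) y.
  by exists x.
- move=> n; split=> //; apply/seteqP; split=> // y _.
  by have [z <-] := sf n y; exists z.
exists Phi, k; split=> // n y z yz.
have [a ay] := approximation_surj (aP n) (projection n y).
have d1 := tr y n a ay; rewrite yz in ay; have d2 := tr z n a ay.
have := metric_triangle (Phi y) a (Phi z); rewrite (metric_sym (Phi y) a).
by have := mesh_le n; lra.
Qed.

End Freudenthal.

(** * Fixed points and the equivalence of the three statements *)

Lemma fixed_point_free_gap (R : realType) (X : metricType R) (h : X -> X) :
  compact [set: X] -> continuous h -> (forall x, h x <> x) ->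
  exists2 e : R, 0 < e & forall x, e < mdist (h x) x.
Proof.
move=> cX ch hx.
suff h0 : \forall e \near (0:R)^'+, [set: X] `<=` (fun x => e < mdist (h x) x).
  near (0:R)^'+ => e; exists e; first by near: e; exact: nbhs_right_gt.
  suff he : [set: X] `<=` (fun x => e < mdist (h x) x) by move=> x; exact: he.
  by near: e; exact: h0.
apply: ((compact_near_coveringP [set: X]).1 cX) => x _.
(* If [z] and [h z] move by less than [r / 4] each, their distance stays above [r / 2], hence above
   every [e < r / 4]. *)
pose r := mdist (h x) x.
have r40 : 0 < r / 4 by rewrite divr_gt0// mdist_gt0; apply/eqP.
have nh : nbhs x (fun z => mdist (h x) (h z) < r / 4).
  exact: cvgr_dist_lt (ch x) _ r40.
exists ([set z | mdist (h x) (h z) < r / 4] `&` ball x (r / 4),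
    [set e | e < r / 4]).
  split=> /=; last exact: nbhs_right_lt.
  by apply: filterI => //; exact: nbhsx_ballx.
move=> [z e] [[/= hz]]; rewrite ballEmdist /= => xz er.
have := metric_triangle (h x) (h z) x; have := metric_triangle (h z) z x.
rewrite -/r (metric_sym z x); lra.
Unshelve. all: by end_near. Qed.

Theorem theorem3p7 (R : realType) (X : metricType R) (hX : continuum X) :
  [<-> ~ fixed_point_property X;

       exists (P : nat -> metricType R) (f : forall l, P l.+1 -> P l),
         [/\ forall l, polyhedron (P l) /\ connected [set: P l],
             forall l, continuous (f l) /\ range (f l) = [set: P l],
             homeomorphic (inverse_limit f) X
           & exists2 g : inverse_limit f -> inverse_limit f,
               continuous g
             & exists (n m : nat) (nm : (n <= m)%N),
                 forall x : P m, ~ T_op n m g x (bonding f nm x)];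

       exists (P : nat -> metricType R) (f : forall l, P l.+1 -> P l),
         [/\ forall l, polyhedron (P l) /\ connected [set: P l],
             forall l, continuous (f l) /\ range (f l) = [set: P l],
             homeomorphic (inverse_limit f) X
           & exists2 g : inverse_limit f -> inverse_limit f,
               continuous g
             & forall (n m : nat) (nm : (n <= m)%N),
                 forall x : P m, ~ T_op n m g x (bonding f nm x)]].
Proof.
have [[x0 _] conX cX] := hX.
set S1 := ~ _; set S2 := exists P, _; set S3 := exists P, _.
have S13 : S1 -> S3.
  move=> /existsNP[h] /not_implyP[ch] /forallNP hx.
  have [e e0 he] := fixed_point_free_gap cX ch hx.
  have [P [f [polyP fP [Phi [k [cPhi ck Phik kPhi close]]]]]] :=
    freudenthal cX x0 conX e0.
  exists P, f; split=> //; first by exists Phi, k.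
  exists (fun y => k (h (Phi y))).
    move=> y; exact: (continuous_comp (continuous_comp (cPhi y) (ch _)) (ck _)).
  (* A violation gives a thread [y] with the same [n]-th coordinate as its image, so [Phi y] and
     [h (Phi y)] are within [e], against the gap. *)
  move=> n m nm _ [_ [y <- <-]].
  rewrite bonding_projection => /close; rewrite kPhi.
  by rewrite leNgt he.
have S21 : S2 -> S1.
  move=> [P [f [_ _ [Phi [k [cPhi ck Phik kPhi]]] [g cg [n [m [nm gP]]]]]]] fpp.
  (* A fixed point [x] of the conjugate of [g] makes [k x] a fixed point of [g], which violates the
     hypothesis at its [m]-th coordinate. *)
  have [|x xE] := fpp (fun x => Phi (g (k x))).
    move=> x.
    exact: (continuous_comp (continuous_comp (ck x) (cg _)) (cPhi _)).
  apply: (gP (projection m (k x))); exists (g (k x)).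
    by exists (k x).
  by rewrite bonding_projection -{2}xE Phik.
have S32 : S3 -> S2.
  move=> [P [f [polyP fP homeo [g cg gP]]]]; exists P, f; split=> //.
  by exists g => //; exists 0%N, 0%N, (leqnn 0); exact: gP.
tfae; [by move=> /S13/S32 | by move=> /S21/S13 | by move=> /S32/S21].
Qed.
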